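(* Let $\mathcal{F}\subseteq 2^{[n]}$ be a hypergraph on the vertex set $[n]$ and let $r=n-alt_2(\mathcal{F})$. Then, for every positive integer $k$, any proper coloring of the graph $\mathrm{KG}^2(\mathcal{F})$ with colors $\{1,2,\ldots,k\}$ must contain a completely multicolored complete bipartite graph $K_{\lceil r/2\rceil,\lfloor r/2\rfloor}$ such that the $r$ different colors occur alternating on the two sides of the bipartite graph with respect to their natural order.
   Context: $[n]=\{1,\ldots,n\}$. A hypergraph $\mathcal{F}\subseteq 2^{[n]}$ is a family of distinct non-empty subsets of $[n]$. The Kneser graph $\mathrm{KG}^2(\mathcal{F})$ has the members of $\mathcal{F}$ as vertices, two being adjacent if they are disjoint. A subgraph is completely multicolored in a coloring if all its vertices receive different colors. The colors alternate on the two sides with respect to their natural order if, listing the $r$ colors increasingly as $c_1<c_2<\cdots<c_r$, the colors $c_i$ with $i$ odd appear on the side of size $\lceil r/2\rceil$ and those with $i$ even on the side of size $\lfloor r/2\rfloor$. For a non-zero $X=(x_1,\ldots,x_n)\in\{-1,0,+1\}^n$, put $X^{+}=\{i:x_i=+1\}$ and $X^{-}=\{i:x_i=-1\}$, and let $alt(X)$ be the maximum length of a subsequence of non-zero terms of $x_1,\ldots,x_n$ in which any two consecutive terms are different. For a permutation $\sigma$ of $[n]$, $alt_\sigma(X)=alt(x_{\sigma(1)},\ldots,x_{\sigma(n)})$. $alt_{2,\sigma}(\mathcal{F})$ is the largest integer $q$ for which there is a non-zero $X\in\{-1,0,+1\}^n$ with $alt_\sigma(X)=q$ such that neither $X^{+}$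 nor $X^{-}$ contains a member of $\mathcal{F}$ (and it is $0$ if no such $X$ exists). Finally $alt_2(\mathcal{F})=\min\{alt_{2,\sigma}(\mathcal{F}):\sigma\in S_n\}$. *)

(* Defs.v *)
From mathcomp Require Import all_boot all_fingroup.

Set Implicit Arguments.
Unset Strict Implicit.
Unset Printing Implicit Defensive.

Section Kneser.
Variables (n : nat) (F : {set {set 'I_n}}).

Definition kneser_vertex : finType := {A : {set 'I_n} | A \in F}.

(* When set0 \notin F, disjoint members are distinct, so this is irreflexive.  *)
Definition kneser : rel kneser_vertex :=
  fun u v => [disjoint sval u & sval v].

End Kneser.

Arguments kneser_vertex {n} F.
Arguments kneser {n} F u v.

Section Colorings.
Variables (T : finType) (e : rel T).

Definition proper_coloring (c : T -> nat) : Prop :=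
  forall u v, e u v -> c u <> c v.

(* A subgraph, not necessarily induced: edges inside L or R are allowed.      *)
Definition complete_bipartite (L R : {set T}) : Prop :=
  [disjoint L & R] /\ {in L & R, forall u v, e u v}.

Definition completely_multicolored (c : T -> nat) (A : {set T}) : Prop :=
  {in A &, injective c}.

Definition increasing_colors (c : T -> nat) (A : {set T}) : seq nat :=
  sort leq (undup [seq c v | v in A]).

(* The list is indexed from 0, so an even index is an odd position in         *)
(* c_1 < c_2 < ... < c_r.                                                     *)
Definition colors_alternate (c : T -> nat) (L R : {set T}) : Prop :=
  let s := increasing_colors c (L :|: R) in
  forall i, i < size s ->
    if odd i then nth 0 s i \in [seq c v | v in R]
    else nth 0 s i \in [seq c v | v in L].

End Colorings.

(* Signs: Some true is +1, Some false is -1, None is 0.                       *)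
Definition sign : finType := option bool.

Definition alternating_seq (t : seq sign) : bool :=
  (None \notin t) && sorted (fun a b => a != b) t.

(* The subsequences of s are the mask m s.                                    *)
Definition alt (s : seq sign) : nat :=
  \max_(m : (size s).-tuple bool | alternating_seq (mask m s)) size (mask m s).

Section SignVectors.
Variable n : nat.
Implicit Types (X : {ffun 'I_n -> sign}) (s : 'S_n) (F : {set {set 'I_n}}).

Definition nonzero X : bool := [exists i, X i != None].

Definition pos_part X : {set 'I_n} := [set i | X i == Some true].
Definition neg_part X : {set 'I_n} := [set i | X i == Some false].

Definition alt_perm s X : nat := alt [seq X (s i) | i <- enum 'I_n].

Definition member_free F X : bool :=
  [forall A in F, ~~ (A \subset pos_part X) && ~~ (A \subset neg_part X)].

(* An empty \max is 0.                                                        *)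
Definition alt2_perm F s : nat :=
  \max_(X : {ffun 'I_n -> sign} | nonzero X && member_free F X) alt_perm s X.

Definition alt2 F : nat :=
  alt2_perm F [arg min_(s < (1%g : 'S_n)) alt2_perm F s].

(* Hence the truncated subtraction n - alt2 F is the integer one.             *)
Lemma alt2_le F : alt2 F <= n.
Proof.
apply/bigmax_leqP => X _; apply/bigmax_leqP => m _.
apply: leq_trans (size_subseq (mask_subseq _ _)) _.
by rewrite size_map size_enum_ord.
Qed.

End SignVectors.

(* Main.v *)
Require Import Defs.
From mathcomp Require Import all_boot all_fingroup.
From mathcomp Require Import zify.

Set Implicit Arguments.
Unset Strict Implicit.
Unset Printing Implicit Defensive.

(** The theorem holds for every linear order p of the ground set in place of an
    optimal one ([zigzag_of_order]), and it follows from a form of Ky Fan's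
    lemma.

    Sign vectors are ordered by X <= Y when Y agrees with X on the support of
    X.  The lemma [sign_fan] says that a map s from non-zero sign vectors to
    bool with s(-X) = ~~ s(X) alternates along some maximal chain
    C_1 < ... < C_n.  This is Ky Fan's lemma on the barycentric subdivision of
    the boundary of the cross-polytope, for the labelling that sends X to the
    size of its support with sign s(X); no two comparable vectors then have
    opposite labels.  It is proved by Fan's parity count.  Let N(d) be the parity of the number of
    alternating chains, with a positive top sign, that are maximal among the
    vectors supported on the first d coordinates.  Among the first d+1
    coordinates, restrict to the hemisphere where the last one is not negative,
    and count the pairs of a maximal chain and a member whose removal leaves an
    alternating chain with a positive top sign.  For a fixed chain that number is odd
    exactly when the chain itself alternates, with either top sign, so that the
    total is N(d+1) by antipodality.  On the other hand a facet inside the hemisphere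
    lies in two maximal chains and a facet on the boundary sphere in one, so
    that the total is N(d).  Hence N(n) = N(0) = 1.

    To use it, let a be the largest alternation number of a non-zero
    vector that contains no member of F in its positive or its negative part.  Give X the
    sign of its first non-zero entry, and the size alt(X), when alt(X) <= a.
    Otherwise X contains members; take one of largest color, let the sign
    tell in which part of X it lies, and let the size be a plus that color.
    The two parts cannot share their largest color, since a member of one is
    disjoint from a member of the other; hence the sign is antisymmetric.
    The size grows strictly whenever the sign changes along X <= Y
    ([label_size_lt]).  So along the alternating chain C_1 < ... < C_n the
    size of C_i is at least i, and each of the r = n - a vectors C_i with
    i > a provides a member.  Their colors increase with i, and they lie
    alternately in the two disjoint parts of C_n: this is the required complete
    bipartite graph. *)

(** * Parity and alternating sequences of signs *)

(** Pairs {x, f x} contribute twice the same value, which cancels modulo 2. *)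
Lemma xor_involution (T : finType) (P g : pred T) (f : T -> T) :
    involutive f -> (forall x, P (f x) = P x) ->
    (forall x, P x -> f x != x) -> (forall x, P x -> g (f x) = g x) ->
  \big[addb/false]_(x | P x) g x = false.
Proof.
move=> fK Pf f_neq gf; pose up x := enum_rank x < enum_rank (f x).
rewrite (bigID up) /= [X in _ (+) X](reindex_inj (inv_inj fK)) /=.
rewrite [X in X (+) _](_ : _ =
  \big[addb/false]_(x | P (f x) && ~~ up (f x)) g (f x)) ?addbb //.
apply: eq_big => [x | x /andP[Px _]]; last by rewrite gf.
rewrite Pf /up fK -leqNgt ltn_neqAle; case: (boolP (P x)) => //= /f_neq.
by rewrite val_eqE (inj_eq enum_rank_inj) eq_sym => ->.
Qed.

Fixpoint alternates_from (b : bool) (l : seq bool) : bool :=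
  if l is x :: l' then (x == b) && alternates_from (~~ b) l' else true.

Definition omit (T : Type) (i : nat) (l : seq T) : seq T := take i l ++ drop i.+1 l.

Lemma omit0 (T : Type) (x : T) l : omit 0 (x :: l) = l.
Proof. by rewrite /omit /= drop0. Qed.

(** The count of facets of one simplex in Fan's argument.  Deleting a term of a
    sequence that alternates leaves an alternating sequence only at the two
    ends, and exactly one of the two ends leaves a sequence starting with b.
    If the sequence does not alternate but some deletion does, then it has a
    single pair of equal neighbours, and the deletions of either one leave the
    same sequence. *)
Lemma xor_alternates_omit b l : l != [::] ->
  \big[addb/false]_(i < size l) alternates_from b (omit i l)
    = alternates_from true l (+) alternates_from false l.
Proof.
elim: l b => [//|x [|y l] IHl] b _.
  by rewrite big_ord1 omit0; case: x.
rewrite big_ord_recl omit0.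
rewrite (eq_bigr (fun i : 'I_(size (y :: l)) =>
   (x == b) && alternates_from (~~ b) (omit i (y :: l)))); last by [].
rewrite -(big_distrr (x == b)) /= IHl //.
case: x y b {IHl} => [] [] [] /=.
all: by case: (alternates_from true l); case: (alternates_from false l).
Qed.

Lemma alternates_from_nth b l i : alternates_from b l -> i.+1 < size l ->
  nth true l i.+1 = ~~ nth true l i.
Proof.
elim: l b i => [//|x l IHl] b [|i] /= /andP[xb Al] lt_i; last exact: IHl Al lt_i.
by case: l lt_i Al {IHl} => //= y l _ /andP[/eqP-> _]; rewrite (eqP xb).
Qed.

Lemma alternates_from_negb b l :
  alternates_from (~~ b) [seq ~~ x | x <- l] = alternates_from b l.
Proof. by elim: l b => //= x l IHl b; rewrite IHl; case: x b => [] []. Qed.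

(** * Sign vectors and signed words *)

Section SignVectors.
Variable n : nat.
Local Notation vector := {ffun 'I_n -> sign}.
Local Notation letter := ('I_n * bool)%type.
Implicit Types (X Y : vector) (v w : seq letter) (z : letter).

Definition opp_sign : sign -> sign := omap negb.
Definition opp_vec X : vector := [ffun i => opp_sign (X i)].
Definition vec_le X Y := forall i, X i != None -> Y i = X i.

(** A word of letters (i, b) with distinct i stands for the sign vector that
    has sign b at i; its suffixes then stand for a chain of sign vectors. *)
Definition vec_of v : vector :=
  [ffun i => if (i, true) \in v then Some true
             else if (i, false) \in v then Some false else None].

Definition opp_letter z : letter := (z.1, ~~ z.2).

Lemma opp_letterK : involutive opp_letter.
Proof. by case=> i b; rewrite /opp_letter negbK. Qed.

Lemma vec_of_perm v w : perm_eq v w -> vec_of v = vec_of w.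
Proof. by move/perm_mem=> vw; apply/ffunP=> i; rewrite !ffunE !vw. Qed.

Lemma uniq_letters v i b :
  uniq (unzip1 v) -> (i, b) \in v -> (i, ~~ b) \in v -> False.
Proof.
elim: v => [//|[j b'] v IHv] /= /andP[jv Uv]; rewrite !inE !xpair_eqE.
case: eqP => [->|_] /=; last by move/IHv; apply.
have nv x : (j, x) \in v = false.
  by apply: contraNF jv => ?; apply/mapP; exists (j, x).
by rewrite !nv !orbF => /eqP->; case: b'.
Qed.

Lemma vec_ofE v i b :
  uniq (unzip1 v) -> (vec_of v i == Some b) = ((i, b) \in v).
Proof.
move=> Uv; rewrite ffunE; have := @uniq_letters v i true Uv.
case: ((i, true) \in v) / boolP => tv; case: ((i, false) \in v) / boolP => fv no;
  case: b; rewrite ?tv ?fv ?(negPf tv) ?(negPf fv) //.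
by case: no.
Qed.

Lemma mem_opp v z : (z \in map opp_letter v) = (opp_letter z \in v).
Proof. by rewrite -{1}[z]opp_letterK (mem_map (inv_inj opp_letterK)). Qed.

Lemma vec_of_opp v : uniq (unzip1 v) ->
  vec_of (map opp_letter v) = opp_vec (vec_of v).
Proof.
move=> Uv; apply/ffunP=> i; rewrite !ffunE !mem_opp /opp_letter /=.
have := @uniq_letters v i true Uv.
by case: (_ \in v); case: (_ \in v) => // /(_ isT isT).
Qed.

Lemma vec_of_le v w : uniq (unzip1 w) -> subseq v w -> vec_le (vec_of v) (vec_of w).
Proof.
move=> Uw vw i; case E: (vec_of v i) => [b|//] _.
have Uv: uniq (unzip1 v) by apply: subseq_uniq Uw; apply: map_subseq.
move/eqP: E; rewrite vec_ofE // => /(mem_subseq vw).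
by rewrite -vec_ofE // => /eqP.
Qed.

(** Exchanging the letters at j and j + 1 changes the suffix starting at j + 1
    and, up to order of letters, no other one: this gives the second maximal
    chain through the facet from which the corresponding vector is omitted. *)
Fixpoint swap (j : nat) (w : seq letter) : seq letter :=
  match j, w with
  | 0, x :: y :: t => y :: x :: t
  | j'.+1, x :: t => x :: swap j' t
  | _, _ => w
  end.

Lemma swapK j : involutive (swap j).
Proof. by elim: j => [|j IHj] [|x [|y w]] //=; rewrite IHj. Qed.

Lemma swap_perm j w : perm_eq (swap j w) w.
Proof.
elim: j w => [|j IHj] [|x w] //=; last by rewrite perm_cons.
by case: w => // y w; rewrite (perm_catCA [:: y] [:: x] w).
Qed.

Lemma swap_neq j w : uniq w -> j.+1 < size w -> swap j w != w.
Proof.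
elim: j w => [|j IHj] [|x [|y w]] //=.
  by rewrite inE negb_or eqseq_cons => /andP[/andP[/negPf xy _] _]; rewrite eq_sym xy.
move=> /andP[_ Uw] lt_j; rewrite eqseq_cons eqxx /=; exact: (IHj (y :: w)).
Qed.

(** The counterpart of [swap] for the facet from which the top vector of the
    chain is omitted. *)
Definition opp_head w := if w is z :: w' then opp_letter z :: w' else w.

Lemma opp_headK : involutive opp_head.
Proof. by case=> //= z w; rewrite opp_letterK. Qed.

(** Words using each of the first d coordinates once encode the maximal chains
    of sign vectors supported there; the chain is formed by the suffixes, so
    the head of the word is the coordinate added last. *)
Definition word d w := perm_eq [seq val z.1 | z <- w] (iota 0 d).

Lemma word_uniq d w : word d w -> uniq (unzip1 w).
Proof.
move=> Ww; apply: (@map_uniq _ _ val); rewrite -map_comp.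
by rewrite (perm_uniq Ww) iota_uniq.
Qed.

Lemma word_perm d v w : perm_eq v w -> word d v = word d w.
Proof. by move=> vw; rewrite /word; have /permPl-> := perm_map (fun z => val z.1) vw. Qed.

Lemma word_opp d w : word d (map opp_letter w) = word d w.
Proof. by rewrite /word -map_comp. Qed.

Lemma word_opp_head d w : word d (opp_head w) = word d w.
Proof. by case: w. Qed.

(** * Ky Fan's lemma *)

Section Fan.
Variable s : vector -> bool.
Hypothesis s_opp : forall X, nonzero X -> s (opp_vec X) = ~~ s X.

Fixpoint signs w : seq bool :=
  if w is z :: w' then s (vec_of w) :: signs w' else [::].

Lemma size_signs w : size (signs w) = size w.
Proof. by elim: w => //= z w ->. Qed.

Lemma nth_signs w i : i < size w -> nth true (signs w) i = s (vec_of (drop i w)).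
Proof. by elim: w i => [//|z w IHw] [|i] //= /IHw. Qed.

Lemma vec_of_nonzero z v : uniq (unzip1 (z :: v)) -> nonzero (vec_of (z :: v)).
Proof.
move=> U; apply/existsP; exists z.1.
have: vec_of (z :: v) z.1 == Some z.2.
  by rewrite vec_ofE //; case: z {U} => i b; rewrite mem_head.
by move/eqP->.
Qed.

Lemma signs_opp w : uniq (unzip1 w) -> signs (map opp_letter w) = map negb (signs w).
Proof.
elim: w => //= z w IHw /[dup] U /andP[_ /IHw->].
by rewrite -[_ :: map _ w]/(map opp_letter (z :: w)) vec_of_opp // s_opp // vec_of_nonzero.
Qed.

Lemma omit_signs_swap j w : omit j.+1 (signs (swap j w)) = omit j.+1 (signs w).
Proof.
elim: j w => [|j IHj] [|x w] //.
- case: w => [//|y w] /=.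
  rewrite /omit /= !drop0 (@vec_of_perm [:: y, x & w] [:: x, y & w]) //.
  by rewrite (perm_catCA [:: y] [:: x] w).
- rewrite -[LHS]/(s (vec_of (x :: swap j w)) :: omit j.+1 (signs (swap j w))) IHj.
  by rewrite (@vec_of_perm _ (x :: w)) // perm_cons swap_perm.
Qed.

(** The number N(d), modulo 2, of alternating maximal chains supported on the
    first d coordinates with a positive sign at the top vector. *)
Definition parity d : bool :=
  \big[addb/false]_(w : d.-tuple letter | word d w) alternates_from true (signs w).

Lemma parity0 : parity 0 = true.
Proof.
rewrite /parity (big_pred1 [tuple]) // => w.
by rewrite tuple0; apply/esym/eqP.
Qed.

Lemma size_swap j w : size (swap j w) = size w.
Proof. exact: perm_size (swap_perm j w). Qed.

Lemma size_opp_head w : size (opp_head w) = size w.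
Proof. by case: w. Qed.

Definition lift_to_tuple (f : seq letter -> seq letter)
    (sf : forall w, size (f w) = size w) d (w : d.-tuple letter) :
    d.-tuple letter :=
  Tuple (introT eqP (etrans (sf w) (size_tuple w))).

(** The double count in the hemisphere [half], where the coordinate d occurs
    with a positive sign. *)
Lemma parityS d : d < n -> parity d.+1 = parity d.
Proof.
move=> ltdn; pose z : letter := (Ordinal ltdn, true).
pose half w := word d.+1 w && (z \in w).
have word_z w : word d.+1 w -> (opp_letter z \in w) = (z \notin w).
  move=> Ww; have Uw := word_uniq Ww.
  have: d \in [seq val y.1 | y <- w] by rewrite (perm_mem Ww) mem_iota /=.
  case/mapP=> -[i b] iw /= di.
  have Ei : i = Ordinal ltdn by apply: val_inj.
  rewrite Ei in iw; apply/idP/idP => [zw | ].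
    by apply/negP=> zw'; apply: (uniq_letters Uw zw' zw).
  by case: b iw => // ->.
pose opp_tuple := @lift_to_tuple (map opp_letter) (size_map _) d.+1.
have opp_tupleK : involutive opp_tuple.
  by move=> w; apply: val_inj; rewrite /= (mapK opp_letterK).
(* Antipodality carries the negative hemisphere to the positive one, and
   chains with positive top sign to chains with negative top sign. *)
have ->: parity d.+1 = \big[addb/false]_(w : d.+1.-tuple letter | half w)
   (alternates_from true (signs w) (+) alternates_from false (signs w)).
  rewrite /parity (bigID (fun w : d.+1.-tuple letter => z \in w)) /=.
  rewrite big_split; congr (_ (+) _).
  rewrite (reindex_inj (inv_inj opp_tupleK)); apply: eq_big => w /=.
    rewrite word_opp /half; case Ww: (word d.+1 w) => //=.
    by rewrite mem_opp word_z // negbK.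
  rewrite word_opp => /andP[/word_uniq Uw _].
  by rewrite signs_opp // -[true]/(~~ false) alternates_from_negb.
(* The count of alternating facets takes the place of each summand. *)
rewrite (eq_bigr (fun w : d.+1.-tuple letter =>
   \big[addb/false]_(i < d.+1) alternates_from true (omit i (signs w)))); last first.
  move=> w _; rewrite -(xor_alternates_omit true).
    by rewrite size_signs size_tuple.
  by rewrite -size_eq0 size_signs size_tuple.
(* For each omitted position other than the top one, the chains sharing the
   facet are paired by [swap]. *)
rewrite exchange_big big_ord_recl /= [X in _ (+) X]big1 => [|j _]; last first.
  pose sw := @lift_to_tuple (swap j) (size_swap j) d.+1.
  apply: (xor_involution (f := sw)) => [w|w|w|w _].
  - by apply: val_inj; rewrite /= swapK.
  - rewrite /half (word_perm _ (swap_perm j w)).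
    by rewrite (perm_mem (swap_perm j w)).
  - case/andP=> /word_uniq/map_uniq Uw _.
    by rewrite -val_eqE swap_neq // size_tuple ltnS ltn_ord.
  - by rewrite -/(_ j.+1) omit_signs_swap.
(* Facets without their top vector: if the coordinate d has already occurred,
   then the head may take either sign; otherwise the head is +d and the facet
   is a maximal chain for d. *)
rewrite addbF (bigID (fun w : d.+1.-tuple letter => z \in behead w)) /=.
rewrite [X in X (+) _](xor_involution (f := @lift_to_tuple opp_head size_opp_head d.+1)) /=.
- rewrite (reindex_onto (fun w : d.-tuple letter => [tuple of z :: w]) (@behead_tuple _ _)) /=.
    apply: eq_big => [w | w _]; last by rewrite omit0.
    rewrite andbC -val_eqE /= eqxx /half mem_head andbT.
    have ->: word d.+1 (z :: w) = word d w.
      rewrite /word -addn1 iotaD /= add0n perm_sym perm_catC /= perm_cons.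
      exact: perm_sym.
    rewrite andbC; case Ww: (word d w); rewrite ?andbF //= andbT.
    apply/negP=> zw; have: d \in [seq val y.1 | y <- w] by apply/mapP; exists z.
    by rewrite (perm_mem Ww) mem_iota ltnn.
  move=> w /andP[/andP[_ zw] zw']; apply: val_inj => /=.
  case/tupleP: w zw zw' => y w; rewrite /= inE.
  by case: eqP => [->|_ /= ->].
- by move=> w; apply: val_inj; rewrite /= opp_headK.
- move=> w; rewrite /half word_opp_head; case/tupleP: w => y w /=.
  by rewrite !inE; case: (z \in w); rewrite ?orbT ?andbF.
- move=> w; case/tupleP: w => y w _; rewrite -val_eqE /= eqseq_cons negb_and.
  by apply/orP; left; case: y => i []; rewrite /opp_letter xpair_eqE andbF.
- by move=> w _; case/tupleP: w => y w /=; rewrite !omit0.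
Qed.

Lemma parity_true d : d <= n -> parity d.
Proof.
elim: d => [_|d IHd ltdn]; first by rewrite parity0.
by rewrite parityS // IHd // ltnW.
Qed.

(** Ky Fan's lemma for labels that consist of a sign and of the size of the
    support.  The change of sign at each step makes C 1, ..., C n distinct, hence
    a maximal chain. *)
Theorem sign_fan : exists C : nat -> vector,
  [/\ forall i, 0 < i <= n -> nonzero (C i),
      forall i j, i <= j -> vec_le (C i) (C j)
    & forall i, 0 < i < n -> s (C i.+1) = ~~ s (C i)].
Proof.
have [w /andP[Ww Aw]] : exists w : n.-tuple letter,
    word n w && alternates_from true (signs w).
  apply/existsP; move: (parity_true (leqnn n)); apply: contraLR.
  rewrite negb_exists => /forallP no; rewrite /parity big1 // => w Ww.
  by apply: negbTE; move: (no w); rewrite Ww.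
have Uw := word_uniq Ww.
have Ud i : uniq (unzip1 (drop i w)).
  by apply: subseq_uniq Uw; apply/map_subseq/drop_subseq.
exists (fun i => vec_of (drop (n - i) w)); split=> [i /andP[i0 lei]|i j ij|i /andP[i0 ltin]].
- have: size (drop (n - i) w) = i by rewrite size_drop size_tuple subKn.
  case E: (drop _ _) => [|y v] Es; first by rewrite -Es in i0.
  by apply: vec_of_nonzero; rewrite -E.
- apply: vec_of_le => //.
  have -> : n - i = (n - i - (n - j)) + (n - j) by rewrite subnK // leq_sub2l.
  by rewrite -drop_drop drop_subseq.
- have ni : n - i = (n - i.+1).+1 by rewrite subnS prednK // subn_gt0.
  have lt1 : n - i < size w by rewrite size_tuple ltn_subrL i0 (leq_ltn_trans _ ltin).
  have := alternates_from_nth (i := n - i.+1) Aw; rewrite size_signs -ni lt1 => /(_ isT).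
  by rewrite !nth_signs // ?(leq_trans _ lt1) // ?ni // => ->; rewrite negbK.
Qed.
End Fan.
End SignVectors.

(** * The alternation number of a sequence of signs *)

Lemma alternating_cons a t :
  alternating_seq (a :: t) =
  [&& a != None, alternating_seq t & (t == [::]) || (head None t != a)].
Proof.
rewrite /alternating_seq inE negb_or eq_sym; case: t => [|b t] /=.
  by rewrite !andbT.
by rewrite -!andbA [b == a]eq_sym; do !bool_congr.
Qed.

Lemma size_le_alt (t l : seq sign) :
  subseq t l -> alternating_seq t -> size t <= alt l.
Proof.
case/subseqP=> m sm -> At.
by apply: (leq_bigmax_cond (Tuple (introT eqP sm))) At.
Qed.

Lemma alt_witness (l : seq sign) :
  exists t, [/\ subseq t l, alternating_seq t & size t = alt l].
Proof.
have: 0 < #|[pred m : (size l).-tuple bool | alternating_seq (mask m l)]|.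
  by apply/card_gt0P; exists [tuple of nseq (size l) false]; rewrite inE mask_false.
case/(eq_bigmax_cond (fun m : (size l).-tuple bool => size (mask m l))) => m Am Em.
by exists (mask m l); rewrite mask_subseq /alt Em.
Qed.

Definition support_seq (l : seq sign) : seq sign := [seq a <- l | a != None].

Lemma subseq_support (t l : seq sign) :
  alternating_seq t -> subseq t (support_seq l) = subseq t l.
Proof.
case/andP=> t_nz _; rewrite subseq_filter.
by rewrite (_ : all _ t) //; apply/allP => a at_; apply: contraNneq t_nz => <-.
Qed.

Lemma alt_mono (l l' : seq sign) :
  subseq (support_seq l) (support_seq l') -> alt l <= alt l'.
Proof.
move=> ll'; have [t [tl At <-]] := alt_witness l.
apply: (size_le_alt _ At); rewrite -subseq_support //.
by apply: subseq_trans ll'; rewrite subseq_support.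
Qed.

Lemma alt_gt0 (l : seq sign) : support_seq l != [::] -> 0 < alt l.
Proof.
case E: (support_seq l) => [//|a f] _.
have af: a \in support_seq l by rewrite E mem_head.
move: af; rewrite mem_filter => /andP[a_nz al].
apply: (@size_le_alt [:: a]); first by rewrite sub1seq.
by rewrite alternating_cons a_nz.
Qed.

(** A longest alternating subsequence t of l must start with the first
    non-zero sign of l, which could otherwise be put in front of t.  If l'
    starts with the other sign b, then b :: t is a subsequence of l'. *)
Lemma alt_strict_mono (l l' : seq sign) :
    subseq (support_seq l) (support_seq l') -> support_seq l != [::] ->
    head None (support_seq l) != head None (support_seq l') ->
  alt l < alt l'.
Proof.
case E: (support_seq l) => [//|a f]; case E': (support_seq l') => [//|b f'].
move=> /= sub _ neq_ab; rewrite (negPf neq_ab) in sub.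
have nz x k g : support_seq k = x :: g -> x != None.
  by move=> Ek; move: (mem_head x g); rewrite -Ek mem_filter => /andP[].
have [t [tl At szt]] := alt_witness l; have tf := tl; rewrite -subseq_support // E in tf.
have head_t: t != [::] -> head None t = a.
  case: t tl At szt tf => [//|x t] tl At szt; rewrite [subseq _ _]/=.
  case: eqP => //= neq_xa tf _.
  have Aat : alternating_seq [:: a, x & t].
    by rewrite alternating_cons (nz _ _ _ E) At /=; apply/eqP.
  have: size [:: a, x & t] <= alt l.
    by apply: (size_le_alt _ Aat); rewrite -subseq_support // E /= eqxx.
  by rewrite -szt /= ltnn.
have Abt : alternating_seq (b :: t).
  rewrite alternating_cons (nz _ _ _ E') At /=; case: eqP => //= /eqP/head_t->.
  exact: neq_ab.
rewrite -szt; apply: (size_le_alt (t := b :: t)) => //.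
by rewrite -subseq_support // E' /= eqxx; apply: subseq_trans tf sub.
Qed.

Lemma support_opp l : support_seq (map opp_sign l) = map opp_sign (support_seq l).
Proof. by rewrite /support_seq filter_map; congr map; apply: eq_filter; case. Qed.

Lemma alt_opp l : alt (map opp_sign l) = alt l.
Proof.
have le_opp k : alt k <= alt (map opp_sign k).
  have [t [tk /andP[t_nz t_alt] <-]] := alt_witness k.
  rewrite -(size_map opp_sign t); apply: size_le_alt; first exact: map_subseq.
  rewrite /alternating_seq sorted_map; apply/andP; split.
    by apply: contra t_nz => /mapP[[//|] ].
  apply: sub_sorted t_alt => a b; apply: contraNN.
  by move: a b => [[]|] [[]|].
apply/eqP; rewrite eqn_leq le_opp andbT.
by rewrite -{2}(mapK (f := opp_sign) (g := opp_sign) _ l) ?le_opp // => -[[]|].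
Qed.

(** * Alternation of a sign vector along a linear order *)

Section Vectors.
Variables (n : nat) (p : 'S_n).
Implicit Types X Y : {ffun 'I_n -> sign}.

Definition entries X : seq sign := [seq X (p i) | i <- enum 'I_n].

Lemma alt_permE X : alt_perm p X = alt (entries X). Proof. by []. Qed.

Lemma entries_opp X : entries (opp_vec X) = map opp_sign (entries X).
Proof. by rewrite /entries -map_comp; apply: eq_map => i /=; rewrite ffunE. Qed.

Lemma support_entries_le X Y :
  vec_le X Y -> subseq (support_seq (entries X)) (support_seq (entries Y)).
Proof.
move=> XY.
have EX: support_seq (entries X) = [seq Y (p i) | i <- enum 'I_n & X (p i) != None].
  rewrite /support_seq /entries filter_map; apply/eq_in_map => i.
  by rewrite mem_filter => /andP[/XY->].
rewrite subseq_filter filter_all EX /=.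
exact/map_subseq/filter_subseq.
Qed.

Lemma support_entries_nonzero X : nonzero X -> support_seq (entries X) != [::].
Proof.
case/existsP=> i Xi; have: X i \in support_seq (entries X).
  rewrite mem_filter Xi; apply/mapP; exists (p^-1%g i); rewrite ?mem_enum //.
  by rewrite permKV.
by case: (support_seq _).
Qed.

Definition leading_sign X : bool := head None (support_seq (entries X)) == Some true.

Lemma leading_signE X : nonzero X ->
  head None (support_seq (entries X)) = Some (leading_sign X).
Proof.
move/support_entries_nonzero; rewrite /leading_sign.
have := filter_all (fun a : sign => a != None) (entries X).
rewrite -/(support_seq _).
by case: (support_seq _) => [//|[[]|] l].
Qed.

Lemma leading_sign_opp X : nonzero X ->
  leading_sign (opp_vec X) = ~~ leading_sign X.
Proof.
move=> X_nz; have := leading_signE X_nz; rewrite {2}/leading_sign entries_opp support_opp.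
by case: (support_seq _) => //= a l ->; case: (leading_sign X).
Qed.

Lemma alt_perm_opp X : alt_perm p (opp_vec X) = alt_perm p X.
Proof. by rewrite !alt_permE entries_opp alt_opp. Qed.

Lemma alt_perm_le X Y : vec_le X Y -> alt_perm p X <= alt_perm p Y.
Proof. by move/support_entries_le/alt_mono. Qed.

Lemma alt_perm_gt0 X : nonzero X -> 0 < alt_perm p X.
Proof. by move/support_entries_nonzero/alt_gt0. Qed.

Lemma vec_le_nonzero X Y : vec_le X Y -> nonzero X -> nonzero Y.
Proof. by move=> XY /existsP[i Xi]; apply/existsP; exists i; rewrite XY. Qed.

Lemma alt_perm_lt X Y : vec_le X Y -> nonzero X ->
  leading_sign X != leading_sign Y -> alt_perm p X < alt_perm p Y.
Proof.
move=> XY X_nz neq; apply: alt_strict_mono; first exact: support_entries_le.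
  exact: support_entries_nonzero.
by rewrite !leading_signE // (vec_le_nonzero XY).
Qed.

Definition part (b : bool) X : {set 'I_n} := if b then pos_part X else neg_part X.

Lemma in_part b X i : (i \in part b X) = (X i == Some b).
Proof. by case: b; rewrite inE. Qed.

Lemma part_opp b X : part b (opp_vec X) = part (~~ b) X.
Proof. by apply/setP=> i; rewrite !in_part ffunE; case: (X i) b => [[]|] []. Qed.

Lemma part_le b X Y : vec_le X Y -> part b X \subset part b Y.
Proof. by move=> XY; apply/subsetP=> i; rewrite !in_part => /eqP Xi; rewrite XY Xi. Qed.

Lemma part_disjoint b X : [disjoint part b X & part (~~ b) X].
Proof.
by case: b; rewrite disjoints_subset; apply/subsetP=> i;
  rewrite in_setC !in_part => /eqP->.
Qed.

End Vectors.

(** * The labelling of sign vectors given by a coloring *)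

Section KneserLabel.
Variables (n : nat) (F : {set {set 'I_n}}) (c : kneser_vertex F -> nat).
Hypothesis c_gt0 : forall v, 0 < c v.
Hypothesis c_proper : proper_coloring (kneser F) c.
Variable p : 'S_n.
Implicit Types X Y : {ffun 'I_n -> sign}.
Local Notation a := (alt2_perm F p).

Definition max_color (b : bool) X : nat :=
  \max_(v : kneser_vertex F | sval v \subset part b X) c v.
Definition top_color X : nat := maxn (max_color true X) (max_color false X).

Definition label_sign X : bool :=
  if alt_perm p X <= a then leading_sign p X else max_color false X < max_color true X.

Definition label_size X : nat :=
  if alt_perm p X <= a then alt_perm p X else a + top_color X.

Lemma max_color_le b X Y : vec_le X Y -> max_color b X <= max_color b Y.
Proof.
move=> XY; apply/bigmax_leqP => v vX; apply: leq_bigmax_cond.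
exact: subset_trans vX (part_le b XY).
Qed.

Lemma max_color_witness b X : 0 < max_color b X ->
  exists2 v : kneser_vertex F, sval v \subset part b X & c v = max_color b X.
Proof.
rewrite /max_color => pos.
have: 0 < #|[pred v : kneser_vertex F | sval v \subset part b X]|.
  rewrite lt0n; apply: contraTneq pos => /card0_eq no.
  by rewrite big_pred0 // => v; have := no v; rewrite inE.
by case/(eq_bigmax_cond c) => v vX ->; exists v.
Qed.

(** By definition of a, a vector whose alternation exceeds a contains a member
    of F in one of its two parts. *)
Lemma top_color_gt0 X : nonzero X -> a < alt_perm p X -> 0 < top_color X.
Proof.
move=> X_nz; rewrite ltnNge; apply: contraNltn.
rewrite leqn0 => /eqP top0; apply: (leq_bigmax_cond X); rewrite X_nz /=.
apply/forall_inP => A AF.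
have no b : ~~ (A \subset part b X).
  apply/negP => AX; have: 0 < max_color b X.
    by apply: (bigmax_sup (exist _ A AF)) => //.
  rewrite ltnNge; apply/negP/negPn; rewrite -top0 /top_color.
  by case: (b); rewrite leq_max leqnn ?orbT.
by have := no true; have := no false; rewrite /= => -> ->.
Qed.

(** Members of F in opposite parts are disjoint, hence of different colors. *)
Lemma max_color_neq X : 0 < top_color X -> max_color true X != max_color false X.
Proof.
move=> top_gt0; apply/eqP=> eq_max; move: top_gt0; rewrite /top_color -eq_max maxnn.
move=> /[dup] /max_color_witness[u uX cu]; rewrite eq_max => /max_color_witness[v vX cv].
apply: (@c_proper u v); last by rewrite cu cv.
apply: disjointWl uX _; apply: disjointWr vX _; exact: (part_disjoint true).
Qed.

Lemma top_colorE X : a < alt_perm p X -> top_color X = max_color (label_sign X) X.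
Proof.
move=> lt_a; rewrite /label_sign leqNgt lt_a /top_color /maxn /=.
by case: (ltngtP (max_color true X)).
Qed.

Lemma max_color_opp b X : max_color b (opp_vec X) = max_color (~~ b) X.
Proof. by apply: eq_bigl => v; rewrite part_opp. Qed.

Lemma label_sign_opp X : nonzero X -> label_sign (opp_vec X) = ~~ label_sign X.
Proof.
move=> X_nz; rewrite /label_sign alt_perm_opp; case: (leqP (alt_perm p X)) => [_|lt_a].
  exact: leading_sign_opp.
rewrite !max_color_opp /= ltn_neqAle -leqNgt.
by rewrite (max_color_neq (top_color_gt0 X_nz lt_a)).
Qed.

(** When both alternations exceed a, sizes do not decrease, and equal sizes
    with different signs would mean that the largest colors of the two parts
    of Y coincide. *)
Lemma label_size_lt X Y : vec_le X Y -> nonzero X ->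
  label_sign X != label_sign Y -> label_size X < label_size Y.
Proof.
move=> XY X_nz; have Y_nz := vec_le_nonzero XY X_nz.
have le_alt := alt_perm_le p XY; rewrite /label_sign /label_size.
case: (leqP (alt_perm p X)) => X_a; case: (leqP (alt_perm p Y)) => Y_a.
- exact: alt_perm_lt.
- move=> _; apply: (leq_ltn_trans X_a); rewrite -[X in X < _]addn0 ltn_add2l.
  exact: top_color_gt0.
- by have := leq_trans X_a (leq_trans le_alt Y_a); rewrite ltnn.
rewrite ltn_add2l /top_color; have := max_color_neq (top_color_gt0 Y_nz Y_a).
have := max_color_le true XY; have := max_color_le false XY.
by lia.
Qed.
End KneserLabel.

(** * The alternating bipartite graph *)

Lemma card_parity_ord (r : nat) :
  (#|[set i : 'I_r | ~~ odd i]| = uphalf r) * (#|[set i : 'I_r | odd i]| = r./2).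
Proof.
split; rewrite -sum1dep_card big_mkcond /=; elim: r => [|r IHr];
  rewrite ?big_ord0 // big_ord_recr /= IHr uphalf_half;
  by case: (odd r); rewrite ?addn0 ?addn1.
Qed.

(** The two sides are made of the terms of even and of odd index; since colors
    increase along g, the index of a term is also the rank of its color. *)
Lemma increasing_to_alternating (T : finType) (e : rel T) (c : T -> nat) (r : nat)
    (g : 'I_r -> T) :
    {homo c \o g : i j / i < j >-> i < j} ->
    (forall i j : 'I_r, ~~ odd i -> odd j -> e (g i) (g j)) ->
  exists L R : {set T},
    [/\ #|L| = uphalf r, #|R| = r./2, complete_bipartite e L R,
        completely_multicolored c (L :|: R) & colors_alternate c L R].
Proof.
move=> c_lt e_g.
have cg_inj : injective (c \o g).
  move=> i j /= eq_c; apply: val_inj; case: (ltngtP (val i) (val j)) => //= /c_lt /=.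
    by rewrite eq_c ltnn.
  by rewrite eq_c ltnn.
have g_inj : injective g by move=> i j eq_g; apply: cg_inj; rewrite /= eq_g.
pose L := [set g i | i in [set i : 'I_r | ~~ odd i]].
pose R := [set g i | i in [set i : 'I_r | odd i]].
have LR : L :|: R = [set g i | i in [set: 'I_r]].
  by rewrite -imsetU; congr (g @: pred_of_set _); apply/setP=> i; rewrite !inE orNb.
exists L, R; split.
- by rewrite card_imset // card_parity_ord.
- by rewrite card_imset // card_parity_ord.
- split=> [|u v /imsetP[i i_even ->] /imsetP[j j_odd ->]].
    rewrite disjoints_subset; apply/subsetP=> _ /imsetP[i i_even ->].
    rewrite in_setC; apply/imsetP=> -[j j_odd /g_inj eq_ij].
    by move: i_even j_odd; rewrite eq_ij !inE => /negPf->.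
  by apply: e_g; [move: i_even | move: j_odd]; rewrite inE.
- rewrite LR => _ _ /imsetP[i _ ->] /imsetP[j _ ->] eq_c.
  by congr g; apply: cg_inj.
have colors : increasing_colors c (L :|: R) = [seq c (g i) | i <- enum 'I_r].
  apply: (irr_sorted_eq ltn_trans ltnn).
  - by rewrite ltn_sorted_uniq_leq sort_uniq undup_uniq sort_sorted //; apply: leq_total.
  - rewrite sorted_map; apply: (@sub_sorted _ (relpre val ltn)).
      by move=> i j; apply: c_lt.
    by rewrite -sorted_map val_enum_ord iota_ltn_sorted.
  move=> x; rewrite mem_sort mem_undup LR; apply/imageP/mapP => -[y].
    by case/imsetP=> i _ -> ->; exists i; rewrite ?mem_enum.
  by move=> _ ->; exists (g y); rewrite ?imset_f.
rewrite /colors_alternate colors => i; rewrite size_map size_enum_ord => lt_ir.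
have -> : nth 0 [seq c (g i) | i <- enum 'I_r] i = c (g (Ordinal lt_ir)).
  rewrite (nth_map (Ordinal lt_ir)) ?size_enum_ord //; congr (c (g _)).
  by apply: val_inj; rewrite /= nth_enum_ord.
by case: ifP => i_par; apply/imageP; exists (g (Ordinal lt_ir)) => //;
  apply: imset_f; rewrite inE /= i_par.
Qed.

(** Minimizing [alt2_perm] over p only serves to make the number r largest. *)
Theorem zigzag_of_order (n : nat) (F : {set {set 'I_n}}) (c : kneser_vertex F -> nat)
    (c_gt0 : forall v, 0 < c v) (c_proper : proper_coloring (kneser F) c) (p : 'S_n) :
  let r := n - alt2_perm F p in
  exists L R : {set kneser_vertex F},
    [/\ #|L| = uphalf r, #|R| = r./2,
        complete_bipartite (kneser F) L R,
        completely_multicolored c (L :|: R)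
      & colors_alternate c L R].
Proof.
set a := alt2_perm F p; move=> r.
have [C [C_nz C_le C_alt]] := sign_fan (label_sign_opp c_gt0 c_proper p).
pose size_C i := label_size c p (C i); pose sign_C i := label_sign c p (C i).
have size_C_step i : 0 < i < n -> size_C i < size_C i.+1.
  move=> i_bd; have /andP[i_gt0 /ltnW i_le] := i_bd.
  apply: (label_size_lt c_gt0 c_proper); first exact: C_le.
    by apply: C_nz; rewrite i_gt0.
  by rewrite C_alt //; case: (label_sign _ _ _).
have size_C_lt i j : 0 < i < j -> j <= n -> size_C i < size_C j.
  case/andP=> i_gt0; elim: j => // j IHj; rewrite ltnS leq_eqVlt => /predU1P[<-|ij] jn.
    by apply: size_C_step; rewrite i_gt0.
  apply: ltn_trans (IHj ij (ltnW jn)) (size_C_step _ _).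
  by rewrite jn (leq_ltn_trans _ ij).
have size_C_ge i : 0 < i <= n -> i <= size_C i.
  elim: i => [//|[|i] IHi] /andP[_ le_in].
    rewrite /size_C /label_size; case: (leqP (alt_perm p (C 1))) => [_|lt_a].
      by apply: alt_perm_gt0; apply: C_nz.
    by rewrite addn_gt0 (top_color_gt0 c_gt0 _ lt_a) ?orbT // C_nz.
  apply: leq_ltn_trans (size_C_step i.+1 le_in); exact/IHi/ltnW.
(* The last r vectors of the chain have size above a, hence provide members. *)
pose top j := a + j.+1.
have top_bd j : j < r -> 0 < top j <= n.
  by rewrite /top addnS /= ltn_subRL.
have alt_top j : j < r -> a < alt_perm p (C (top j)).
  move/top_bd/size_C_ge; rewrite /size_C /label_size; case: (leqP (alt_perm p _)) => // le_a.
  by move/leq_trans/(_ le_a); rewrite /top addnS ltnNge leq_addr.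
have color_witness (j : 'I_r) : exists v : kneser_vertex F,
    (sval v \subset part (sign_C (top j)) (C (top j))) && (c v == top_color c (C (top j))).
  have lt_a := alt_top j (ltn_ord j).
  have := top_color_gt0 c_gt0 (C_nz _ (top_bd j (ltn_ord j))) lt_a.
  rewrite (top_colorE _ lt_a) => /max_color_witness[v vC cv].
  by exists v; rewrite vC cv /=.
pose g j := xchoose (color_witness j).
have g_part j : sval (g j) \subset part (sign_C (top j)) (C n).
  have /andP[vC _] := xchooseP (color_witness j).
  apply: (subset_trans vC); apply/part_le/C_le.
  by have /andP[] := top_bd j (ltn_ord j).
have g_color j : a + c (g j) = size_C (top j).
  have /andP[_ /eqP->] := xchooseP (color_witness j).
  by rewrite /size_C /label_size leqNgt alt_top.
have sign_top j : j < r -> sign_C (top j) = odd j (+) sign_C (top 0).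
  elim: j => [//|j IHj] lt_jr.
  have -> : top j.+1 = (top j).+1 by rewrite /top addnS.
  rewrite /sign_C C_alt -/(sign_C (top j)) ?(IHj (ltnW lt_jr)) ?addNb //.
  by have := top_bd _ lt_jr; rewrite /top !addnS.
apply: (increasing_to_alternating (g := g)) => [i j ij|i j i_even j_odd].
  rewrite /= -(ltn_add2l a) !g_color size_C_lt //; last by case/andP: (top_bd j (ltn_ord j)).
  by rewrite /top addnS /= -addnS ltn_add2l.
apply: disjointWl (g_part i) _; apply: disjointWr (g_part j) _.
by rewrite (sign_top i) // (sign_top j) // j_odd (negPf i_even) part_disjoint.
Qed.

Theorem theorem5 (n : nat) (F : {set {set 'I_n}}) (F_no_empty : set0 \notin F)
    (k : nat) (k_gt0 : 0 < k) (c : kneser_vertex F -> nat)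
    (c_range : forall v, 1 <= c v <= k)
    (c_proper : proper_coloring (kneser F) c) :
  let r := n - alt2 F in
  exists L R : {set kneser_vertex F},
    [/\ #|L| = uphalf r, #|R| = r./2,
        complete_bipartite (kneser F) L R,
        completely_multicolored c (L :|: R)
      & colors_alternate c L R].
Proof.
have c_gt0 v : 0 < c v by case/andP: (c_range v).
exact: zigzag_of_order.
Qed.
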